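(* Let $k \geq 1$ and $m \geq 1$ be integers with $m \not\equiv 0 \bmod 5$, and let $n = 5^k m$. Then the polynomials $F_{5^k m}(q)$ and $G_{5^k m}(q)$ are both divisible by $[5^k]_{q^m}$ (in $\mathbb{Z}[q]$).
   Context: For an indeterminate $q$ and an integer $n\ge 0$ let $[n]_q = \frac{1-q^n}{1-q} = 1+q+\cdots+q^{n-1}$; correspondingly $[n]_{q^m} = \frac{1-q^{nm}}{1-q^m} = 1 + q^m + \cdots + q^{(n-1)m}$. Let $\begin{bmatrix} n \\ k \end{bmatrix} = \frac{[n]_q [n-1]_q\cdots[n-k+1]_q}{[1]_q[2]_q\cdots[k]_q}$ be the $q$-binomial coefficient (a polynomial in $q$ with integer coefficients). The Schur-Carlitz $q$-Fibonacci numbers are the polynomials in $\mathbb{Z}[q]$ $$F_n(q) = \sum_{k=0}^{\lfloor (n-1)/2 \rfloor} q^{k^2} \begin{bmatrix} n-1-k \\ k \end{bmatrix}, \qquad G_n(q) = \sum_{k=0}^{\lfloor (n-1)/2 \rfloor} q^{k^2+k} \begin{bmatrix} n-1-k \\ k \end{bmatrix}.$$ Equivalently, $F_0(q)=0$, $F_1(q)=1$, $F_n(q)=F_{n-1}(q)+q^{n-2}F_{n-2}(q)$ and $G_0(q)=0$, $G_1(q)=1$, $G_n(q)=G_{n-1}(q)+q^{n-1}G_{n-2}(q)$ for $n\ge 2$. *)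

(* Defs.v *)
From mathcomp Require Import all_boot all_order all_algebra.
From mathcomp Require Import zify ring.

Set Implicit Arguments.
Unset Strict Implicit.
Unset Printing Implicit Defensive.

Import GRing.Theory.
Local Open Scope ring_scope.

(* The indeterminate q is 'X; [n]_{q^m} is [qint 'X^m n]. *)
Definition qint (x : {poly int}) (n : nat) : {poly int} :=
  \sum_(i < n) x ^+ i.

Definition qbinom_num (n k : nat) : {poly int} := \prod_(i < k) qint 'X (n - i).
Definition qbinom_den (k : nat) : {poly int} := \prod_(i < k) qint 'X i.+1.

(* The denominator is monic, so %/ is genuine Euclidean division in Z[q]; it is
   exact by qbinomM. For k > n the numerator has the factor [0]_q = 0. *)
Definition qbinom (n k : nat) : {poly int} := qbinom_num n k %/ qbinom_den k.

(* floor((n-1)/2) + 1 = n.+1./2, so 0 <= k <= floor((n-1)/2) iff k < n.+1./2;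
   for n = 0 the sum is empty. *)
Definition qfibF (n : nat) : {poly int} :=
  \sum_(k < n.+1./2) 'X^(k ^ 2)%N * qbinom (n - 1 - k) k.
Definition qfibG (n : nat) : {poly int} :=
  \sum_(k < n.+1./2) 'X^(k ^ 2 + k)%N * qbinom (n - 1 - k) k.

Lemma qintS x n : qint x n.+1 = qint x n + x ^+ n.
Proof. by rewrite /qint big_ord_recr. Qed.

Lemma qintD x a b : qint x (a + b) = qint x a + x ^+ a * qint x b.
Proof.
rewrite /qint big_split_ord /= mulr_sumr; congr (_ + _).
by apply: eq_bigr => i _; rewrite exprD.
Qed.

Lemma size_qint n : size (qint 'X n) = n.
Proof.
suff -> : qint 'X n = \poly_(i < n) 1.
  by case: n => [|n]; rewrite ?size_poly_eq ?poly_def ?big_ord0 ?size_poly0.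
by rewrite poly_def; apply: eq_bigr => i _; rewrite scale1r.
Qed.

Lemma monic_qint n : qint 'X n.+1 \is monic.
Proof.
rewrite qintS monicE lead_coefDr ?lead_coefXn //.
by rewrite size_polyXn size_qint.
Qed.

Lemma monic_qbinom_den k : qbinom_den k \is monic.
Proof. by apply: monic_prod => i _; apply: monic_qint. Qed.

Fixpoint qpascal (n k : nat) : {poly int} :=
  match n, k with
  | _, 0 => 1
  | 0, _.+1 => 0
  | n.+1, k.+1 => 'X^(n - k) * qpascal n k + qpascal n k.+1
  end.

Lemma qpascalM n k : qpascal n k * qbinom_den k = qbinom_num n k.
Proof.
elim: n k => [|n IHn] [|k].
- by rewrite /qbinom_den /qbinom_num !big_ord0 mulr1.
- rewrite /= mul0r /qbinom_num big_ord_recl subn0.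
  by rewrite {1}/qint big_ord0 mul0r.
- by rewrite /qbinom_den /qbinom_num !big_ord0 mulr1.
have denS : qbinom_den k.+1 = qbinom_den k * qint 'X k.+1.
  by rewrite /qbinom_den big_ord_recr.
have numS : qbinom_num n k.+1 = qbinom_num n k * qint 'X (n - k).
  by rewrite /qbinom_num big_ord_recr.
have numSS : qbinom_num n.+1 k.+1 = qint 'X n.+1 * qbinom_num n k.
  by rewrite /qbinom_num big_ord_recl.
rewrite [qpascal _ _]/= mulrDl IHn numS numSS denS mulrA -(mulrA _ (qpascal _ _)).
rewrite IHn; case: (leqP k n) => [le_kn | lt_nk].
  have -> : n.+1 = (n - k + k.+1)%N by rewrite addnS subnK.
  by rewrite qintD; ring.
have -> : qbinom_num n k = 0.
  rewrite /qbinom_num (bigD1 (Ordinal lt_nk)) //= subnn.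
  by rewrite {1}/qint big_ord0 mul0r.
by rewrite !(mulr0, mul0r) addr0.
Qed.

Lemma qbinom_pascal n k : qbinom n k = qpascal n k.
Proof.
by rewrite /qbinom -qpascalM Pdiv.IdomainMonic.mulpK // monic_qbinom_den.
Qed.

Lemma qbinomM n k : qbinom n k * qbinom_den k = qbinom_num n k.
Proof. by rewrite qbinom_pascal qpascalM. Qed.

Lemma qpascal_gt n k : (n < k)%N -> qpascal n k = 0.
Proof.
elim: n k => [|n IHn] [|k] //= lt_nk.
by rewrite !IHn ?mulr0 ?addr0 // ltnW.
Qed.

Lemma qpascal0 n : qpascal n 0 = 1.
Proof. by case: n. Qed.

Lemma qfib_widen (e : nat -> nat) n N : (n.+1./2 <= N)%N ->
  \sum_(k < n.+1./2) 'X^(e k) * qbinom (n - 1 - k) k =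
  \sum_(k < N) (if n == 0 then 0 else 'X^(e k) * qpascal (n - 1 - k) k).
Proof.
case: n => [|n] leN; first by rewrite big_ord0 big1.
rewrite (big_ord_widen N (fun k => 'X^(e k) * qbinom (n.+1 - 1 - k) k) leN).
rewrite big_mkcond /=; apply: eq_bigr => k _.
case: ifP => [_|/negbT]; first by rewrite qbinom_pascal.
by move=> ?; rewrite qpascal_gt ?mulr0 //; lia.
Qed.

Lemma qfib_rec (e : nat -> nat) (c n : nat) :
  (forall j, (2 * j < n)%N -> (e j.+1 + (n.-1 - 2 * j) = e j + (n + c))%N) ->
  let f n := \sum_(k < n.+1./2) 'X^(e k) * qbinom (n - 1 - k) k in
  f n.+2 = f n.+1 + 'X^(n + c) * f n.
Proof.
move=> eS f; rewrite /f.
rewrite (@qfib_widen e n.+2 n.+3); last by lia.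
rewrite (@qfib_widen e n.+1 n.+3); last by lia.
rewrite (@qfib_widen e n n.+2); last by lia.
rewrite /= !(big_ord_recl n.+2) /= mulr_sumr !subn0 !subn1 /=.
rewrite !qpascal0 -addrA -big_split /=; congr (_ + _).
apply: eq_bigr => -[j lt_j] _; rewrite /bump /= add1n subSS.
case: n eS {f lt_j} => [|n] eS.
  by rewrite !sub0n /= !mulr0 addr0.
rewrite /= subSS.
have [le_jn | lt_nj] := leqP j n; last first.
  have [-> ->] : (n.+1 - j = 0)%N /\ (n - j = 0)%N by lia.
  by case: j lt_nj => // j _; rewrite /= !mulr0 addr0.
rewrite subSn //= mulrDr addrC; congr (_ + _).
have [le2 | gt2] := leqP (2 * j) n; last first.
  by rewrite qpascal_gt ?mulr0 //; lia.
rewrite !mulrA -!exprD; congr ('X^_ * _).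
by have := eS j; rewrite /=; lia.
Qed.

Lemma qfibF0 : qfibF 0 = 0. Proof. by rewrite /qfibF big_ord0. Qed.
Lemma qfibG0 : qfibG 0 = 0. Proof. by rewrite /qfibG big_ord0. Qed.

Lemma qfibF1 : qfibF 1 = 1.
Proof. by rewrite /qfibF big_ord1 qbinom_pascal mulr1. Qed.
Lemma qfibG1 : qfibG 1 = 1.
Proof. by rewrite /qfibG big_ord1 qbinom_pascal mulr1. Qed.

Lemma qfibFSS n : qfibF n.+2 = qfibF n.+1 + 'X^n * qfibF n.
Proof.
by have := @qfib_rec (fun k => k ^ 2)%N 0 n; rewrite addn0; apply=> j; nia.
Qed.

Lemma qfibGSS n : qfibG n.+2 = qfibG n.+1 + 'X^(n.+1) * qfibG n.
Proof.
by have := @qfib_rec (fun k => k ^ 2 + k)%N 1 n; rewrite addn1; apply=> j; nia.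
Qed.

(* Main.v *)
Require Import Defs.
From mathcomp Require Import all_boot all_order all_algebra.
From mathcomp Require Import all_field.
From mathcomp Require Import zify ring.

Import GRing.Theory.
Local Open Scope ring_scope.

(** [[5^k]_{q^m} = (q^n - 1) / (q^m - 1)] is monic with simple complex roots,
    namely the primitive [d]-th roots of unity for [d | n], [d] not dividing
    [m]; as [5] does not divide [m], all these [d] are multiples of [5].  So it
    suffices that [F_n] and [G_n] vanish at a primitive [d]-th root of unity [z]
    when [5 | d | n].  The coefficients of the recurrences are [d]-periodic at
    [z], which reduces this to [n = d], and reversing continuants gives
    [F_d(z) = G_d(z^-1)], which reduces it to [G_d].  Finally Schur's identity
    [G_n = \sum_j (-1)^j q^(j(5j-3)/2) [n; floor((n-5j)/2) + 1]]
    expresses [G_d] through Gaussian binomials with lower index nonzero mod [5],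
    and these all vanish at [z]. *)

(** * Gaussian binomials with integer lower index *)

(** Pascal's rule replaces the usual quotient so that [q] may be a root of unity; an integer [k]
    allows shifts by [5 * i] without side conditions. *)
Fixpoint gbin {R : fieldType} (q : R) (n : nat) (k : int) : R :=
  if n is n'.+1 then gbin q n' (k - 1) + q ^ k * gbin q n' k else (k == 0)%:R.

Lemma gbinS {R : fieldType} (q : R) n k :
  gbin q n.+1 k = gbin q n (k - 1) + q ^ k * gbin q n k.
Proof. by []. Qed.

Lemma gbinS_dual {R : fieldType} (q : R) n k : q != 0 ->
  gbin q n.+1 k = gbin q n k + q ^ (n.+1%:Z - k) * gbin q n (k - 1).
Proof.
move=> q0; elim: n k => [|n IHn] k.
  rewrite /= subr_eq0; have [->|k1] := eqVneq k 1.
    by rewrite /= !mulr0 mulr1 addrC.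
  by have [->|k0] := eqVneq k 0; rewrite ?expr0z ?mulr1 ?mulr0 ?addr0 ?add0r.
rewrite gbinS {1}IHn {1}(IHn k) (gbinS q n k) (gbinS q n (k - 1)).
have e1 : n.+1%:Z - (k - 1) = n.+2%:Z - k by lia.
have e2 : q ^ k * q ^ (n.+1%:Z - k) = q ^ (n.+2%:Z - k) * q ^ (k - 1).
  by rewrite -!expfzDr //; congr (q ^ _); lia.
by rewrite e1 mulrDr mulrA e2; ring.
Qed.

Lemma gbin_eq0 {R : fieldType} (q : R) n k :
  (k < 0) || (n%:Z < k) -> gbin q n k = 0.
Proof.
elim: n k => [|n IHn] k hk /=; first by have /negbTE -> : k != 0 by lia.
by rewrite !IHn ?mulr0 ?addr0 //; lia.
Qed.

(** The left side mimics [g n.+2 - g n.+1 - q ^+ n.+1 * g n]; [gbinS] followed by [gbinS_dual]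
    leaves a single binomial. [gbin_stepr] takes the two rules in the other order. *)
Lemma gbin_stepl {R : fieldType} (q : R) n k : q != 0 ->
  gbin q n.+2 k - gbin q n.+1 (k - 1) - q ^+ n.+1 * gbin q n (k - 1)
  = q ^ k * gbin q n k.
Proof.
move=> q0; rewrite gbinS (gbinS_dual _ n k) //.
have e : q ^+ n.+1 = q ^ k * q ^ (n.+1%:Z - k).
  by rewrite -expfzDr // exprnP; congr (q ^ _); lia.
by rewrite e; ring.
Qed.

Lemma gbin_stepr {R : fieldType} (q : R) n k : q != 0 ->
  gbin q n.+2 k - gbin q n.+1 k - q ^+ n.+1 * gbin q n (k - 1)
  = q ^ (n.+2%:Z - k) * gbin q n (k - 2).
Proof.
move=> q0; rewrite gbinS_dual // (gbinS _ n (k - 1)).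
have e : q ^+ n.+1 = q ^ (n.+2%:Z - k) * q ^ (k - 1).
  by rewrite -expfzDr // exprnP; congr (q ^ _); lia.
have -> : k - 2 = k - 1 - 1 by lia.
by rewrite e; ring.
Qed.

(** This follows by equating the two Pascal rules; being free of division, it can be used when
    [q ^+ n.+1 = 1]. *)
Lemma gbin_absorb {R : fieldType} (q : R) n k : q != 0 ->
  (1 - q ^ k) * gbin q n.+1 k = (1 - q ^+ n.+1) * gbin q n (k - 1).
Proof.
move=> q0; have := gbinS_dual q n k q0; rewrite gbinS => e.
have e2 : q ^+ n.+1 = q ^ k * q ^ (n.+1%:Z - k).
  by rewrite -expfzDr // exprnP; congr (q ^ _); lia.
rewrite e2; apply/eqP; rewrite -subr_eq0; apply/eqP.
transitivity (q ^ k * (gbin q n k + q ^ (n.+1%:Z - k) * gbin q n (k - 1)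
   - (gbin q n (k - 1) + q ^ k * gbin q n k))); first by ring.
by rewrite -e subrr mulr0.
Qed.

(** * Schur's identity *)

(* The summands [j = 2 i] and [j = 2 i + 1] of Schur's sum. *)
Definition schur_term {R : fieldType} (q : R) (n : nat) (i : int) : R :=
  q ^ (10 * i * i - 3 * i) * gbin q n (n./2%:Z + 1 - 5 * i)
  - q ^ (10 * i * i + 7 * i + 1) * gbin q n ((uphalf n)%:Z - 2 - 5 * i).

(** For odd [n], [gbin_stepr] on the first summand and [gbin_stepl] on the second leave equal
    remainders, which cancel. *)
Lemma schur_term_odd {R : fieldType} (q : R) n i : q != 0 -> odd n ->
  schur_term q n.+2 i - schur_term q n.+1 i - q ^+ n.+1 * schur_term q n i = 0.
Proof.
move=> q0 on; rewrite /schur_term.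
set a := q ^ (10 * i * i - 3 * i); set b := q ^ (10 * i * i + 7 * i + 1).
have := gbin_stepr q n ((n.+2)./2%:Z + 1 - 5 * i) q0.
have := gbin_stepl q n ((uphalf n.+2)%:Z - 2 - 5 * i) q0.
have -> : (uphalf n.+2)%:Z - 2 - 5 * i - 1 = (uphalf n)%:Z - 2 - 5 * i by lia.
have -> : (uphalf n.+1)%:Z - 2 - 5 * i = (uphalf n)%:Z - 2 - 5 * i by lia.
have -> : (n.+2)./2%:Z + 1 - 5 * i - 1 = n./2%:Z + 1 - 5 * i by lia.
have -> : (n.+2)./2%:Z + 1 - 5 * i - 2 = (uphalf n.+2)%:Z - 2 - 5 * i by lia.
have -> : (n.+1)./2%:Z + 1 - 5 * i = (n.+2)./2%:Z + 1 - 5 * i by lia.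
move=> hB hA.
have e : a * q ^ (n.+2%:Z - ((n.+2)./2%:Z + 1 - 5 * i))
       = b * q ^ ((uphalf n.+2)%:Z - 2 - 5 * i).
  by rewrite /a /b -!expfzDr //; congr (q ^ _); lia.
have hA' := congr1 ( *%R a) hA; have hB' := congr1 ( *%R b) hB.
rewrite mulrA e -mulrA -hB' in hA'.
by move/eqP: hA'; rewrite -subr_eq0 => /eqP <-; ring.
Qed.

(** For even [n] this is the remainder that [gbin_stepl] leaves from the summand [j = 2 i]; the
    summand [j = 2 i + 1] leaves the same expression at [i + 1], so the sum over [i] telescopes. *)
Definition schur_flux {R : fieldType} (q : R) (n : nat) (i : int) : R :=
  q ^ (10 * i * i - 8 * i + n./2%:Z + 2) * gbin q n (n./2%:Z + 2 - 5 * i).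

Lemma schur_term_even {R : fieldType} (q : R) n i : q != 0 -> ~~ odd n ->
  schur_term q n.+2 i - schur_term q n.+1 i - q ^+ n.+1 * schur_term q n i
  = schur_flux q n i - schur_flux q n (i + 1).
Proof.
move=> q0 on; rewrite /schur_term /schur_flux.
set a := q ^ (10 * i * i - 3 * i); set b := q ^ (10 * i * i + 7 * i + 1).
have := gbin_stepl q n ((n.+2)./2%:Z + 1 - 5 * i) q0.
have := gbin_stepr q n ((uphalf n.+2)%:Z - 2 - 5 * i) q0.
have -> : (uphalf n.+2)%:Z - 2 - 5 * i - 1 = (uphalf n)%:Z - 2 - 5 * i by lia.
have -> : (uphalf n.+1)%:Z - 2 - 5 * i = (uphalf n.+2)%:Z - 2 - 5 * i by lia.
have -> : (n.+2)./2%:Z + 1 - 5 * i - 1 = n./2%:Z + 1 - 5 * i by lia.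
have -> : (n.+1)./2%:Z + 1 - 5 * i = n./2%:Z + 1 - 5 * i by lia.
have -> : (uphalf n.+2)%:Z - 2 - 5 * i - 2 = n./2%:Z + 2 - 5 * (i + 1) by lia.
have -> : (n./2)%:Z + 2 - 5 * i = (n.+2)./2%:Z + 1 - 5 * i by lia.
move=> hB hA.
have -> : 10 * i * i - 8 * i + (n./2)%:Z + 2
  = 10 * i * i - 3 * i + ((n.+2)./2%:Z + 1 - 5 * i) by lia.
have -> : 10 * (i + 1) * (i + 1) - 8 * (i + 1) + (n./2)%:Z + 2
  = 10 * i * i + 7 * i + 1 + (n.+2%:Z - ((uphalf n.+2)%:Z - 2 - 5 * i)) by lia.
rewrite (expfzDr (10 * i * i - 3 * i)) // (expfzDr (10 * i * i + 7 * i + 1)) //.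
by rewrite -/a -/b -!mulrA -hA -hB; ring.
Qed.

(* The sum over all integers [i] is truncated to [-L <= i <= L], outside of which
   the Gaussian binomials vanish. *)
Lemma schur_identity {R : fieldType} (q : R) (g : nat -> R) :
    q != 0 -> g 0%N = 0 -> g 1%N = 1 ->
    (forall n, g n.+2 = g n.+1 + q ^+ n.+1 * g n) ->
  forall L n, (n <= L)%N ->
  g n = \sum_(t < L.*2.+1) schur_term q n (t%:Z - L%:Z).
Proof.
move=> q0 g0 g1 gSS L.
pose S n := \sum_(0 <= t < L.*2.+1) schur_term q n (t%:Z - L%:Z).
have SSS n : (n <= L)%N -> S n.+2 = S n.+1 + q ^+ n.+1 * S n.
  move=> nL; apply/eqP; rewrite -subr_eq0 opprD addrA mulr_sumr -!sumrB.
  case on: (odd n).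
    by rewrite big1 // => t _; apply: schur_term_odd.
  rewrite (telescope_sumr_eq (fun t => - schur_flux q n (t%:Z - L%:Z))) //.
    (* The boundary fluxes sit at [i = - L] and [i = L + 1], where the lower index is above [n] and
       below [0] respectively. *)
    by rewrite /schur_flux !gbin_eq0 ?mulr0 ?subrr //; lia.
  move=> t _; rewrite schur_term_even ?on // opprK addrC.
  by congr (- schur_flux q n _ + _); lia.
have S0 : S 0%N = 0.
  by apply: big1 => t _; rewrite /schur_term !gbin_eq0 ?mulr0 ?subrr //; lia.
have S1 : (0 < L)%N -> S 1%N = 1.
  (* Only [t = L], that is [i = 0], contributes, through [[1; 1] = 1]. *)
  move=> L0; rewrite /S (big_cat_nat _ (n := L)) //=; last by lia.
  rewrite (@big_ltn _ _ _ L); last by lia.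
  rewrite big_nat big1 => [|t /andP [_ tL]]; last first.
    by rewrite /schur_term !gbin_eq0 ?mulr0 ?subrr //; lia.
  rewrite big_nat big1 => [|t /andP [tL _]]; last first.
    by rewrite /schur_term !gbin_eq0 ?mulr0 ?subrr //; lia.
  rewrite subrr /schur_term /= !mulr0 !(subr0, addr0, add0r).
  by rewrite !expr0z /=; ring.
suff H n : ((n <= L)%N -> g n = S n) /\ ((n < L)%N -> g n.+1 = S n.+1).
  by move=> n nL; rewrite (proj1 (H n)) // /S big_mkord.
elim: n => [|n [IH1 IH2]]; first by rewrite g0 S0 g1; split=> // ?; rewrite S1.
split=> // nL; rewrite gSS SSS ?IH1 ?IH2 //; lia.
Qed.

(** * Vanishing at primitive roots of unity *)

Lemma prim_root_expz {R : fieldType} {d : nat} {z : R} (k : int) :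
  d.-primitive_root z -> z ^ k = 1 -> (d %| `|k|)%N.
Proof.
move=> zd; rewrite (prim_order_dvd zd); case: k => [n|n] /=.
  by rewrite -exprnP => ->.
by rewrite NegzE -exprnN => /(canRL (@invrK _)) ->; rewrite invr1.
Qed.

Lemma prim_rootV {R : fieldType} (d : nat) (z : R) :
  d.-primitive_root z^-1 = d.-primitive_root z.
Proof.
rewrite /primitive_root_of_unity; congr (_ && _); apply: eq_forallb => i.
by rewrite !unity_rootE exprVn invr_eq1.
Qed.

Lemma carlitzG_prim_root {R : fieldType} (q : R) (g : nat -> R) d :
    d.-primitive_root q -> (5 %| d)%N -> g 0%N = 0 -> g 1%N = 1 ->
    (forall n, g n.+2 = g n.+1 + q ^+ n.+1 * g n) ->
  g d = 0.
Proof.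
move=> qd d5 g0 g1 gSS.
have d0 := prim_order_gt0 qd; have qd1 := prim_expr_order qd.
have q0 : q != 0 by rewrite (prim_root_eq0 qd) -lt0n.
(* Absorption at upper index [d] has right side [0], while [q ^ k != 1] since [5] divides [d] but
   not [k]. *)
have bin0 k : ~~ (5 %| `|k|)%N -> gbin q d k = 0.
  move=> k5; have := gbin_absorb q d.-1 k q0.
  rewrite prednK // qd1 subrr mul0r => /eqP; rewrite mulf_eq0 => /orP [|/eqP //].
  rewrite subr_eq0 eq_sym => /eqP /(prim_root_expz _ qd) dk.
  by rewrite (dvdn_trans d5 dk) in k5.
rewrite (schur_identity q g q0 g0 g1 gSS d d) //; apply: big1 => t _.
(* As [5] divides [d], both lower indices are [1] or [3] mod [5]. *)
by rewrite /schur_term !bin0 ?mulr0 ?subrr //; lia.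
Qed.

(* Reversal of continuants: [u n.+1 * v (d - n) + q ^+ n * u n * v (d - n.+1)]
   does not depend on [n]. *)
Lemma carlitz_reversal {R : fieldType} (q : R) (u v : nat -> R) d :
    (0 < d)%N -> q != 0 -> q ^+ d = 1 ->
    u 0%N = 0 -> u 1%N = 1 -> (forall n, u n.+2 = u n.+1 + q ^+ n * u n) ->
    v 0%N = 0 -> v 1%N = 1 ->
    (forall n, v n.+2 = v n.+1 + q^-1 ^+ n.+1 * v n) ->
  u d = v d.
Proof.
move=> d0 q0 qd u0 u1 uSS v0 v1 vSS.
have inv n : (n < d)%N ->
    u n.+1 * v (d - n)%N + q ^+ n * u n * v (d - n.+1)%N = v d.
  elim: n => [|n IHn] nd; first by rewrite u0 u1 subn0 mulr0 mul0r addr0 mul1r.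
  rewrite -{}IHn; last by lia.
  have -> : (d - n = (d - n.+2).+2)%N by lia.
  have -> : (d - n.+1 = (d - n.+2).+1)%N by lia.
  (* Since [q ^+ d = 1], the next coefficient for [u] is also the one that produces [v (d - n)]. *)
  have e : q ^+ n.+1 = q^-1 ^+ (d - n.+2).+1.
    rewrite exprVn; apply: (mulIf (x := q ^+ (d - n.+2).+1)).
      by rewrite expf_neq0.
    rewrite mulVf ?expf_neq0 // -exprD -qd; congr (q ^+ _); lia.
  by rewrite vSS uSS -e; ring.
(* At [n = d - 1] the second term contains [v 0 = 0] and the first is [u d * v 1]. *)
have := inv d.-1; rewrite prednK // subnn v0 mulr0 addr0.
have -> : (d - d.-1 = 1)%N by lia.
by rewrite v1 mulr1; apply; lia.
Qed.

(** By periodicity [u (d + n)] solves the same recurrence in [n], with initial values [0] and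
    [u d.+1]; hence it equals [u d.+1 * u n]. *)
Lemma periodic_rec_eq0 {R : fieldType} (c u : nat -> R) d :
    u 0%N = 0 -> u 1%N = 1 -> (forall n, u n.+2 = u n.+1 + c n * u n) ->
    (forall n, c (d + n)%N = c n) -> u d = 0 ->
  forall l, u (l * d)%N = 0.
Proof.
move=> u0 u1 uSS cd ud.
have H n : u (d + n)%N = u d.+1 * u n /\ u (d + n.+1)%N = u d.+1 * u n.+1.
  elim: n => [|n [IH1 IH2]].
    by rewrite addn0 addn1 ud u0 u1 mulr0 mulr1.
  split=> //; rewrite 2!addnS uSS -addnS IH1 IH2 cd uSS; ring.
elim=> [|l IHl]; first by rewrite mul0n.
by rewrite mulSn (proj1 (H _)) IHl mulr0.
Qed.

(** * Evaluation of [F_n] and [G_n] at complex roots of unity *)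

Local Notation pC := (map_poly (intr : int -> algC)).

Lemma horner_pCX (p : {poly int}) n z :
  (pC ('X^n * p)).[z] = z ^+ n * (pC p).[z].
Proof. by rewrite rmorphM /= map_polyXn hornerM hornerXn. Qed.

Lemma qfib_prim_root (z : algC) d l : d.-primitive_root z -> (5 %| d)%N ->
  root (pC (qfibF (l * d))) z /\ root (pC (qfibG (l * d))) z.
Proof.
move=> zd d5; have d0 := prim_order_gt0 zd; have zd1 := prim_expr_order zd.
pose u w n := (pC (qfibF n)).[w]; pose v w n := (pC (qfibG n)).[w].
have u0 w : u w 0%N = 0 by rewrite /u qfibF0 rmorph0 horner0.
have v0 w : v w 0%N = 0 by rewrite /v qfibG0 rmorph0 horner0.
have u1 w : u w 1%N = 1 by rewrite /u qfibF1 rmorph1 hornerC.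
have v1 w : v w 1%N = 1 by rewrite /v qfibG1 rmorph1 hornerC.
have uSS w n : u w n.+2 = u w n.+1 + w ^+ n * u w n.
  by rewrite /u qfibFSS rmorphD hornerD horner_pCX.
have vSS w n : v w n.+2 = v w n.+1 + w ^+ n.+1 * v w n.
  by rewrite /v qfibGSS rmorphD hornerD horner_pCX.
have vd w : d.-primitive_root w -> v w d = 0.
  by move=> wd; apply: (carlitzG_prim_root w _ d).
have ud : u z d = 0.
  rewrite (carlitz_reversal z (u z) (v z^-1) d) //; last first.
    by rewrite (prim_root_eq0 zd) -lt0n.
  by rewrite vd // prim_rootV.
split; apply/rootP.
  apply: (periodic_rec_eq0 (fun n => z ^+ n) (u z)) => // n.
  by rewrite exprD zd1 mul1r.
apply: (periodic_rec_eq0 (fun n => z ^+ n.+1) (v z)) => //; last exact: vd.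
by move=> n; rewrite -addnS exprD zd1 mul1r.
Qed.

(** * From complex roots to divisibility in [Z[q]] *)

(** Division by a monic [d] already works over the integers; divisibility over [algC] forces the
    remainder, of smaller degree, to be [0]. *)
Lemma dvdp_pC (p d : {poly int}) : d \is monic -> pC d %| pC p ->
  exists Q, p = Q * d.
Proof.
move=> dm dp; exists (Pdiv.Ring.rdivp p d).
rewrite {1}(Pdiv.RingMonic.rdivp_eq dm p).
suff -> : Pdiv.Ring.rmodp p d = 0 by rewrite addr0.
apply/eqP; apply: contraTT dp => r0.
rewrite (Pdiv.RingMonic.rdivp_eq dm p) rmorphD rmorphM /=.
rewrite dvdp_addr ?dvdp_mulIr //; apply/negP => /dvdp_leq.
have inj : injective (intr : int -> algC) by exact: intr_inj.
rewrite map_poly_eq0_id0 ?size_map_inj_poly //; last first.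
  by rewrite intr_eq0 lead_coef_eq0.
by move/(_ r0); rewrite leqNgt Pdiv.Ring.ltn_rmodpN0 // monic_neq0.
Qed.

Lemma qint_geom m a : qint 'X^m a * ('X^m - 1) = 'X^(a * m) - 1.
Proof. by rewrite mulrC /qint -subrX1 -exprM mulnC. Qed.

Lemma monic_qintXn m a : (0 < m)%N -> (0 < a)%N -> qint 'X^m a \is monic.
Proof.
move=> m0 a0; rewrite -(monicMr _ (monicXnsubC 1 m0)) polyC1 qint_geom -polyC1.
by apply: monicXnsubC; rewrite muln_gt0 a0.
Qed.

(** [X^(a m) - 1] is separable, so its factor [[a]_{q^m}] is a product of distinct linear factors
    and is coprime to the cofactor [X^m - 1]; hence its roots satisfy [z ^+ m != 1]. *)
Lemma qint_dvd_of_roots m a (p : {poly int}) : (0 < m)%N -> (0 < a)%N ->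
    (forall z : algC, z ^+ (a * m) = 1 -> z ^+ m != 1 -> root (pC p) z) ->
  exists Q, p = Q * qint 'X^m a.
Proof.
move=> m0 a0 hroot; have dm := monic_qintXn m a m0 a0.
apply: dvdp_pC => //; set D := pC _.
have DE : D * ('X^m - 1) = 'X^(a * m) - 1.
  have := congr1 (fun p => pC p) (qint_geom m a).
  by rewrite /= rmorphM !rmorphB /= !map_polyXn rmorph1.
have : separable_poly (D * ('X^m - 1)).
  by rewrite DE separable_Xn_sub_1 // Num.Theory.pnatr_eq0 -lt0n muln_gt0 a0.
rewrite separable_mul => /and3P [sepD _ cop].
have [r Dr] := closed_field_poly_normal D.
have lD : lead_coef D = 1.
  by rewrite lead_coef_map_id0 ?(monicP dm) ?oner_eq0.
rewrite lD scale1r in Dr; rewrite Dr separable_prod_XsubC in sepD.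
rewrite Dr uniq_roots_dvdp ?uniq_rootsE //; apply/allP => z zr.
have Dz : root D z by rewrite Dr root_prod_XsubC.
apply: hroot.
  apply/eqP; rewrite -subr_eq0; have := congr1 (fun p => p.[z]) DE.
  by rewrite hornerM (rootP Dz) mul0r !hornerE => <-.
by have := coprimep_root cop Dz; rewrite !hornerE subr_eq0.
Qed.

Theorem theorem2p1 (k m n : nat) (hk : (1 <= k)%N) (hm : (1 <= m)%N)
    (hm5 : (m != 0 %[mod 5])%N) (hn : n = (5 ^ k * m)%N) :
  (exists Q : {poly int}, qfibF n = Q * qint 'X^m (5 ^ k)) /\
  (exists Q : {poly int}, qfibG n = Q * qint 'X^m (5 ^ k)).
Proof.
have a0 : (0 < 5 ^ k)%N by rewrite expn_gt0.
have roots (z : algC) : z ^+ (5 ^ k * m) = 1 -> z ^+ m != 1 ->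
    root (pC (qfibF n)) z /\ root (pC (qfibG n)) z.
  move=> zn zm; have n0 : (0 < 5 ^ k * m)%N by rewrite muln_gt0 a0.
  have [d zd dn] := prim_order_exists n0 zn.
  (* Otherwise [d] is coprime to [5 ^ k], hence divides [m], and [z ^+ m = 1]. *)
  have d5 : (5 %| d)%N.
    apply: contraNT zm => nd5; rewrite -(prim_order_dvd zd).
    by rewrite -(@Gauss_dvdr _ (5 ^ k)) // coprimeXr // coprime_sym prime_coprime.
  by rewrite hn -(divnK dn); apply: qfib_prim_root.
by split; apply: qint_dvd_of_roots => // z zn zm; have [] := roots z zn zm.
Qed.
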